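(* Let $(G,L)$ be an instance of MLCM such that no pair of lines has an unavoidable crossing. Then $(G,L)$ has a crossing-free solution, i.e., a feasible line layout with no edge crossings and no vertex crossings.
   Context: An instance $(G,L)$ consists of a graph $G=(V,E)$ embedded in the plane and a set $L$ of simple paths in $G$ (lines). The endpoints of a line are its terminals. For an edge $(u,v)$, $L_{uv}$ is the set of lines containing it. Each vertex is drawn as a polygon with one side (port) per incident edge, in the cyclic order of the embedding. A line layout specifies, for every edge $(u,v)$, linear orders $\pi_{uv}$ and $\pi_{vu}$ of $L_{uv}$, where $\pi_{uv}$ is the clockwise order (w.r.t. the center of $u$'s polygon) in which the lines attach to the port of $u$ for $(u,v)$. Lines $l_1,l_2$ have an edge crossing on $(u,v)$ if $l_1$ precedes $l_2$ in both $\pi_{uv}$ and $\pi_{vu}$. For a vertex $u$, let $\pi_u$ be the cyclic concatenation of the orders at the ports of $u$ in clockwise order; $l_1,l_2$ have a vertex crossing at $u$ if $\pi_u=(\dots l_1\dots l_2\dots l_1\dots l_2\dots)$. A crossing (edge or vertex) of a pair of lines is unavoidable if the pair crosses in every line layout, and avoidable otherwise. A line layout is feasible if it contains no avoidable vertex crossings. MLCM is the problem of finding a feasible layout minimizing the number of crossings. *)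

(* Defs.v *)
From mathcomp Require Import all_boot.

Set Implicit Arguments.
Unset Strict Implicit.
Unset Printing Implicit Defensive.

Section PlaneGraph.
Variables (V : finType) (e : rel V) (ports : V -> seq V).

Definition darts : pred (V * V) := [pred d | e d.1 d.2].

(* [ports v] lists the neighbours of [v] in clockwise order, read cyclically;
   the faces of the embedding are the orbits of [face_next] on [darts]. *)
Definition face_next (d : V * V) : V * V := (d.2, next (ports d.2) d.1).

Definition num_edges : nat := #|darts|./2.

(* Each component is drawn on its own sphere; an isolated vertex has no dart
   and contributes one face. *)
Definition num_faces : nat :=
  fcard face_next darts + #|[pred v | ports v == [::]]|.

(* Euler's formula, summed over the components: |V| - |E| + |F| = 2 |C|,
   i.e. the rotation system [ports] has genus 0. *)
Definition genus0 : Prop :=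
  #|V| + num_faces = num_edges + 2 * n_comp e predT.

End PlaneGraph.

(* A finite simple graph with a (combinatorial) embedding in the plane. *)
Record plane_graph (V : finType) := PlaneGraph {
  edge : rel V;
  ports : V -> seq V;
  edge_sym : symmetric edge;
  edge_irr : irreflexive edge;
  ports_uniq : forall v, uniq (ports v);
  mem_ports : forall u v, (v \in ports u) = edge u v;
  ports_genus0 : genus0 edge ports }.

(* [Line] indexes the set L. A path is undirected, so a vertex sequence and
   its reversal are the same path, and members of L are distinct as paths. *)
Record line_set (V : finType) (G : plane_graph V) (Line : finType) := LineSet {
  route : Line -> seq V;
  route_neq0 : forall l, route l != [::];
  route_path : forall l, sorted (edge G) (route l);
  route_simple : forall l, uniq (route l);
  route_inj : forall l1 l2,
    route l1 = route l2 \/ route l1 = rev (route l2) -> l1 = l2 }.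

Section Layout.
Variables (V : finType) (G : plane_graph V).
Variables (Line : finType) (L : line_set G Line).

Definition line_on (u v : V) : pred Line :=
  [pred l | infix [:: u; v] (route L l) || infix [:: v; u] (route L l)].

(* [pi u v] is the clockwise order, seen from [u], at the port of [u] for the
   edge (u,v); its values at non-edges are irrelevant. *)
Definition is_layout (pi : V -> V -> seq Line) : Prop :=
  forall u v, edge G u v -> uniq (pi u v) /\ pi u v =i line_on u v.

Definition precedes (l1 l2 : Line) (s : seq Line) : bool :=
  subseq [:: l1; l2] s.

Definition edge_crossing (pi : V -> V -> seq Line) (u v : V) (l1 l2 : Line) :
    Prop :=
  edge G u v /\
  (precedes l1 l2 (pi u v) /\ precedes l1 l2 (pi v u) \/
   precedes l2 l1 (pi u v) /\ precedes l2 l1 (pi v u)).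

(* A linear representative of the cyclic sequence around [u]. *)
Definition vertex_order (pi : V -> V -> seq Line) (u : V) : seq Line :=
  flatten [seq pi u v | v <- ports G u].

Definition vertex_crossing (pi : V -> V -> seq Line) (u : V) (l1 l2 : Line) :
    Prop :=
  exists k, subseq [:: l1; l2; l1; l2] (rot k (vertex_order pi u)).

Definition crosses (pi : V -> V -> seq Line) (l1 l2 : Line) : Prop :=
  (exists u v, edge_crossing pi u v l1 l2) \/
  (exists u, vertex_crossing pi u l1 l2).

Definition unavoidable (l1 l2 : Line) : Prop :=
  forall pi, is_layout pi -> crosses pi l1 l2.

Definition feasible (pi : V -> V -> seq Line) : Prop :=
  is_layout pi /\
  forall u l1 l2, l1 <> l2 -> vertex_crossing pi u l1 l2 -> unavoidable l1 l2.

End Layout.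

(* Main.v *)
Require Import Defs.
From mathcomp Require Import all_boot.
From Stdlib Require Import Classical_Prop.

Set Implicit Arguments.
Unset Strict Implicit.
Unset Printing Implicit Defensive.

(* The edges are ordered one at a time.  Say that, at an edge (u,v), line [a]
   must precede line [b] when, following both lines beyond [v] (or beyond [u]),
   the first place where they fork or share an already ordered edge says so.
   The demands seen beyond [v] form a strict order, those seen beyond [u] too,
   and the two never contradict each other: agreement is inherited along shared
   paths, and two forks at the ends of a shared path agree since otherwise the
   pair would cross in every layout.  Two lines are incomparable in one
   direction only if one of them stops before any fork or ordered edge; this
   forbids two mutually incomparable pairs of comparable lines, so the union of
   the two orders is acyclic and (u,v) can be ordered by a linear extension.
   Once every edge is ordered, no pair crosses on an edge or at the end of a
   shared edge, and lines sharing no port at a vertex cross there in all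
   layouts or in none. *)

(** * Positions, rotations and filtered pairs in sequences *)

Section Sequences.
Variable T : eqType.
Implicit Types (a b x y : T) (s : seq T) (ss : seq (seq T)).

Lemma index_rev_uniq s x :
  uniq s -> x \in s -> index x (rev s) = size s - (index x s).+1.
Proof.
move=> us xs; have ix : index x s < size s by rewrite index_mem.
have jlt : size s - (index x s).+1 < size s by rewrite ltn_subrL (leq_ltn_trans _ ix).
have xE : nth x (rev s) (size s - (index x s).+1) = x.
  by rewrite nth_rev // (subnSK ix) subKn ?nth_index // ltnW.
by rewrite -{1}xE index_uniq ?rev_uniq ?size_rev.
Qed.

Lemma ltn_index_rev s a b : uniq s -> a \in s -> b \in s ->
  (index a (rev s) < index b (rev s)) = (index b s < index a s).
Proof.
move=> us ha hb; rewrite !index_rev_uniq //.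
by rewrite ltn_sub2lE // index_mem.
Qed.

Lemma subseq2_index s a b : a != b -> b \in s -> index a s < index b s ->
  subseq [:: a; b] s.
Proof.
elim: s => //= x s IH ab; rewrite inE.
case: (x =P a) => [->|_].
  rewrite eqxx (negbTE ab) [b == a]eq_sym (negbTE ab) /= => bs _.
  by rewrite sub1seq.
case: (x =P b) => [->|/eqP xb]; first by rewrite ltn0.
rewrite eq_sym (negbTE xb) ltnS /= => bs lt_ab.
case: (a =P x) => [ax|_]; last exact: IH.
by rewrite sub1seq.
Qed.

Lemma index_subseq2 s a b : uniq s -> subseq [:: a; b] s ->
  index a s < index b s.
Proof.
elim: s => //= x s IH /andP[xs us].
case: (a =P x) => [ax|/eqP ax].
  rewrite -{}ax eqxx sub1seq in xs * => bs.
  by case: (a =P b) => // ab; rewrite ab bs in xs.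
move=> sub; rewrite eq_sym (negbTE ax).
have /mem_subseq sm := sub.
have bs : b \in s by apply: sm; rewrite !inE eqxx orbT.
case: (x =P b) => [xb|_]; first by rewrite xb bs in xs.
by rewrite ltnS IH.
Qed.

Lemma filter_pred2 s a b : a != b -> subseq [:: a; b] s ->
  count_mem a s = 1 -> count_mem b s = 1 -> filter (pred2 a b) s = [:: a; b].
Proof.
move=> ab sub ca cb; apply/esym/eqP.
have sub' : subseq [:: a; b] (filter (pred2 a b) s).
  by rewrite subseq_filter sub /= !eqxx orbT.
have := size_subseq_leqif sub'; case=> _ <- /=.
rewrite size_filter; have := count_predUI (pred1 a) (pred1 b) s.
rewrite ca cb => /eqP; rewrite (_ : count (predI _ _) s = 0) ?addn0; last first.
  apply/eqP; rewrite -leqn0 leqNgt -has_count; apply/hasPn => x _ /=.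
  by apply/negP=> /andP[/eqP -> /eqP h]; rewrite h eqxx in ab.
by move=> /eqP h; rewrite [count _ _]h.
Qed.

Lemma filter_rot (P : pred T) k s :
  exists k', filter P (rot k s) = rot k' (filter P s).
Proof.
exists (size (filter P (take k s))).
by rewrite -[X in rot _ (filter P X)](cat_take_drop k s) !filter_cat rot_size_cat.
Qed.

(** Lifts a rotation seen on two lines only to one of the whole vertex order, so that an alternation
    can be carried from one layout to another. *)
Lemma rot_filter (P : pred T) k s :
  exists k', rot k (filter P s) = filter P (rot k' s).
Proof.
have [k' [dE tE]] : exists k', drop k (filter P s) = filter P (drop k' s) /\
   take k (filter P s) = filter P (take k' s).
  elim: s k => [|x s IH] k /=; first by exists 0.
  case: ifP => Px; last first.
    by have [k' [dE tE]] := IH k; exists k'.+1; rewrite /= Px.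
  case: k => [|k]; first by exists 0; rewrite /= Px.
  by have [k' [dE tE]] := IH k; exists k'.+1; rewrite /= Px dE tE.
by exists k'; rewrite /rot filter_cat dE tE.
Qed.

Lemma flatten_rot ss k :
  exists k', flatten (rot k ss) = rot k' (flatten ss).
Proof.
exists (size (flatten (take k ss))).
by rewrite -[X in rot _ (flatten X)](cat_take_drop k ss) !flatten_cat rot_size_cat.
Qed.

Lemma rot_rot_exists k j s : exists i, rot k (rot j s) = rot i s.
Proof.
elim: k => [|k [i IH]]; first by exists j; rewrite rot0.
have [lt|le] := ltnP k (size s); last first.
  by exists j; rewrite rot_oversize // size_rot leqW.
rewrite rotS ?size_rot // IH.
have [lti|lei] := ltnP i (size s); first by exists i.+1; rewrite (rotS lti).
by rewrite (rot_oversize lei); exists 1.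
Qed.

Lemma rotK_exists k s : exists i, rot i (rot k s) = s.
Proof.
exists (size s - k); rewrite -[RHS](rotK k s) /rotr size_rot //.
Qed.

Definition after s x := drop (index x s).+1 s.

Lemma after_cat s1 s2 x : uniq (s1 ++ x :: s2) -> after (s1 ++ x :: s2) x = s2.
Proof.
rewrite cat_uniq /= => /and3P[_ /norP[xs1 _] _].
rewrite /after index_cat (negbTE xs1) /= eqxx addn0.
by rewrite -cat_rcons drop_size_cat // size_rcons.
Qed.

Lemma uniq_cat_cons_inj x s1 s2 t1 t2 : uniq (s1 ++ x :: s2) ->
  s1 ++ x :: s2 = t1 ++ x :: t2 -> s2 = t2.
Proof. by move=> us E; rewrite -(after_cat us) E after_cat // -E. Qed.

Lemma flatten_subseq ss ss' :
  subseq ss ss' -> subseq (flatten ss) (flatten ss').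
Proof.
elim: ss' ss => [|s' ss' IH] [|s ss] //=; first by rewrite sub0seq.
case: eqP => [->|_] /IH h; first exact: cat_subseq.
by apply: subseq_trans h _; apply: suffix_subseq.
Qed.

(** Every rotation of [y x x y] has two cyclically adjacent equal entries, so none is [a b a b]. *)
Lemma not_alternating a b x y s k : a != b ->
  filter (pred2 a b) s = [:: y; x; x; y] -> ~ subseq [:: a; b; a; b] (rot k s).
Proof.
move=> ab E sub; have [k' E'] := filter_rot (pred2 a b) k s.
have : subseq [:: a; b; a; b] (filter (pred2 a b) (rot k s)).
  by rewrite subseq_filter sub /= !eqxx !orbT.
move/size_subseq_leqif; case=> _; rewrite E' E size_rot eqxx => /esym/eqP.
case: k' {E'} => [|[|[|[|k']]]]; rewrite /rot /= => -[] *; subst;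
  by rewrite eqxx in ab.
Qed.

(** At most one of [a] and [b] occurs, so the filtered sequences have length at most one and equal
    contents make them equal. *)
Lemma filter_pred2_eq a b s s' : uniq s -> uniq s' -> s =i s' ->
  ~~ ((a \in s) && (b \in s)) -> filter (pred2 a b) s = filter (pred2 a b) s'.
Proof.
move=> us us' ss' nab; apply: perm_small_eq; last first.
  by apply: uniq_perm; rewrite ?filter_uniq // => x; rewrite !mem_filter ss'.
rewrite size_filter -(@eq_count _ (predU (pred1 a) (pred1 b))) //.
apply: leq_trans (leq_addr (count (predI (pred1 a) (pred1 b)) s') _) _.
rewrite count_predUI !count_uniq_mem // -!ss'.
by move: nab; case: (a \in s); case: (b \in s).
Qed.

End Sequences.

(* Sorting by the number of predecessors is a topological sort. *)
Lemma linear_extension (T : finType) (Q : rel T) (P : pred T) :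
  transitive Q -> irreflexive Q ->
  exists s, [/\ uniq s, s =i P &
    forall a b, P a -> P b -> Q a b -> index a s < index b s].
Proof.
move=> Qtr Qirr; pose key x := #|[pred y | Q y x]|.
have key_lt a b : Q a b -> key a < key b.
  move=> Qab; apply/proper_card/properP; split.
    by apply/subsetP=> y; rewrite !inE => /Qtr; apply.
  by exists a; rewrite !inE // Qirr.
pose r := relpre key leq; pose s := sort r (enum P).
have us : uniq s by rewrite sort_uniq enum_uniq.
have ms : s =i P by move=> x; rewrite mem_sort mem_enum.
exists s; split=> // a b Pa Pb Qab; rewrite ltnNge; apply/negP=> le_ba.
have rtr : transitive r by move=> x y z; apply: leq_trans.
have ss : sorted r s by apply: sort_sorted => x y; apply: leq_total.
have : r b a.
  apply: (sorted_leq_index rtr _ ss) => //; first by move=> x; apply: leqnn.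
  - by rewrite ms.
  - by rewrite ms.
by rewrite /r /= leqNgt key_lt.
Qed.

(** * Joint linear extension of two strict orders *)

(* If the comparability graph of [L] has no induced pair of disjoint edges,
   then [L R L] collapses to [L]; hence paths in [L] and [R] shorten to length
   at most two. *)
Section JointExtension.
Variables (T : finType) (L R : rel T).
Hypotheses (Ltr : transitive L) (Rtr : transitive R).
Hypotheses (Lirr : irreflexive L) (Rirr : irreflexive R).
Hypothesis LR_consistent : forall a b, L a b -> R b a -> False.

(** For a strict order on a finite set this characterizes the interval orders. The alternatives hold
    trivially when the two pairs overlap. *)
Definition no_2K2 (S : rel T) := forall a b c d, S a b -> S c d ->
  [|| S a c, S c a, S a d, S d a, S b c, S c b, S b d | S d b].

Hypotheses (L22 : no_2K2 L) (R22 : no_2K2 R).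

(** Each of the eight possible comparabilities between the two [L]-pairs yields by transitivity
    either [L a d] or [L c b], and the latter contradicts [R b c]. *)
Lemma LRL_sub a b c d : L a b -> R b c -> L c d -> L a d.
Proof.
move=> ab bc cd; have ncb : ~ L c b by move=> cb; apply: LR_consistent cb bc.
have [] := orP (L22 ab cd); first by move/Ltr; apply.
case/orP=> [ca|]; first by case: ncb; apply: Ltr ca ab.
case/orP=> [//|]; case/orP=> [da|].
  by case: ncb; apply: Ltr cd (Ltr da ab).
case/orP=> [bc'|]; first by apply: Ltr ab (Ltr bc' cd).
case/orP=> [/ncb //|]; case/orP=> [bd|db]; first exact: Ltr ab bd.
by case: ncb; apply: Ltr cd db.
Qed.

Lemma RLR_sub a b c d : R a b -> L b c -> R c d -> R a d.
Proof.
move=> ab bc cd; have ncb : ~ R c b by move=> cb; apply: LR_consistent bc cb.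
have [] := orP (R22 ab cd); first by move/Rtr; apply.
case/orP=> [ca|]; first by case: ncb; apply: Rtr ca ab.
case/orP=> [//|]; case/orP=> [da|].
  by case: ncb; apply: Rtr cd (Rtr da ab).
case/orP=> [bc'|]; first by apply: Rtr ab (Rtr bc' cd).
case/orP=> [/ncb //|]; case/orP=> [bd|db]; first exact: Rtr ab bd.
by case: ncb; apply: Rtr cd db.
Qed.

(** Since alternating paths collapse to length two, this is the whole transitive closure of the
    union of [L] and [R]. *)
Definition joint : rel T := fun a b =>
  [|| L a b, R a b, [exists c, L a c && R c b] | [exists c, R a c && L c b]].

Lemma jointP a b : reflect
  [\/ L a b, R a b, exists2 c, L a c & R c b | exists2 c, R a c & L c b]
  (joint a b).
Proof.
apply: (iffP or4P) => -[h|h|h|h]; try by [constructor 1 | constructor 2].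
- by constructor 3; have /existsP[c /andP[]] := h; exists c.
- by constructor 4; have /existsP[c /andP[]] := h; exists c.
- by constructor 3; case: h => c h1 h2; apply/existsP; exists c; rewrite h1.
- by constructor 4; case: h => c h1 h2; apply/existsP; exists c; rewrite h1.
Qed.

Lemma joint_irr : irreflexive joint.
Proof.
move=> a; apply/negP=> /jointP[||[c h1 h2]|[c h1 h2]].
- by rewrite Lirr.
- by rewrite Rirr.
- exact: LR_consistent h1 h2.
- exact: LR_consistent h2 h1.
Qed.

Lemma joint_L a b c : joint a b -> L b c -> joint a c.
Proof.
move=> /jointP[ab|ab|[d ad db]|[d ad db]] bc; apply/jointP.
- by constructor 1; apply: Ltr ab bc.
- by constructor 4; exists b.
- by constructor 1; apply: LRL_sub ad db bc.
- by constructor 4; exists d => //; apply: Ltr db bc.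
Qed.

Lemma joint_R a b c : joint a b -> R b c -> joint a c.
Proof.
move=> /jointP[ab|ab|[d ad db]|[d ad db]] bc; apply/jointP.
- by constructor 3; exists b.
- by constructor 2; apply: Rtr ab bc.
- by constructor 3; exists d => //; apply: Rtr db bc.
- by constructor 2; apply: RLR_sub ad db bc.
Qed.

Lemma joint_trans : transitive joint.
Proof.
move=> b a c ab /jointP[bc|bc|[d h1 h2]|[d h1 h2]].
- exact: joint_L bc.
- exact: joint_R bc.
- exact: joint_R (joint_L ab h1) h2.
- exact: joint_L (joint_R ab h1) h2.
Qed.

Lemma joint_linear_extension (P : pred T) :
  exists s, [/\ uniq s, s =i P &
    forall a b, P a -> P b -> L a b || R a b -> index a s < index b s].
Proof.
have [s [us ms ls]] := linear_extension P joint_trans joint_irr.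
exists s; split=> // a b Pa Pb ab; apply: ls => //; apply/jointP.
by case/orP: ab => ?; [constructor 1 | constructor 2].
Qed.

End JointExtension.

(** * Lines as oriented paths, and the demands seen beyond an edge *)

Section Lines.
Variables (V : finType) (G : plane_graph V).
Variables (Line : finType) (L : line_set G Line).
Implicit Types (a b c : Line) (u v w x : V) (D : rel V).
Implicit Types (pi : V -> V -> seq Line).

(* The vertices that [a] visits beyond [v] when the edge (u,v) is traversed
   from [u] to [v]; empty when [a] does not contain that edge. *)
Definition tail a u v : seq V :=
  if infix [:: u; v] (route L a) then after (route L a) v
  else if infix [:: v; u] (route L a) then after (rev (route L a)) v
  else [::].

Lemma line_onE a u v : line_on L u v a =
  infix [:: u; v] (route L a) || infix [:: v; u] (route L a).
Proof. by []. Qed.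

Lemma line_on_sym a u v : line_on L u v a = line_on L v u a.
Proof. by rewrite !line_onE orbC. Qed.

Lemma infix2P (r : seq V) u v :
  reflect (exists p q, r = p ++ [:: u, v & q]) (infix [:: u; v] r).
Proof. by apply: (iffP (@infixP _ [:: u; v] r)) => -[p [q ->]]; exists p, q. Qed.

(** Hides the stored direction of a line: an edge of the line can always be read forward in one of
    the two orientations. *)
Definition orients a (r : seq V) := r = route L a \/ r = rev (route L a).

Lemma orients_rev a r : orients a r -> orients a (rev r).
Proof. by case=> ->; [right | left; rewrite revK]. Qed.

Lemma orients_uniq a r : orients a r -> uniq r.
Proof. by case=> ->; rewrite ?rev_uniq route_simple. Qed.

Lemma orients_eq a r r' : orients a r -> orients a r' -> r' = r \/ r' = rev r.
Proof. by case=> ->; case=> ->; rewrite ?revK; auto. Qed.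

Lemma tailE a p q u v : orients a (p ++ [:: u, v & q]) ->
  line_on L u v a /\ tail a u v = q.
Proof.
move=> oa; have := orients_uniq oa; case: oa => E us.
  have H : infix [:: u; v] (route L a) by apply/infix2P; exists p, q.
  rewrite /tail H -E -cat_rcons after_cat ?cat_rcons //.
  by split=> //; rewrite line_onE H.
have E' : route L a = rev q ++ [:: v, u & rev p].
  by rewrite -[LHS]revK -E rev_cat !rev_cons -!cats1 -!catA.
have H : infix [:: v; u] (route L a) by apply/infix2P; exists (rev q), (rev p).
split; first by rewrite line_onE H orbT.
rewrite /tail H; case: ifP => [/infix2P[p' [q' E2]]|_]; last first.
  by rewrite -E -cat_rcons after_cat ?cat_rcons.
(* If the route also contained the edge in the other direction, [u] would occur both before and
   after [v], against simplicity. *)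
have us' : uniq (route L a) := route_simple L a.
have Eq : q' = u :: rev p.
  apply/esym/(@uniq_cat_cons_inj _ v (rev q) _ (rcons p' u)).
    by rewrite -E'.
  by rewrite cat_rcons -E' -E2.
by move: us'; rewrite E2 Eq cat_uniq /= !inE eqxx !orbT !andbF.
Qed.

Lemma line_onP a u v : line_on L u v a ->
  exists p, orients a (p ++ [:: u, v & tail a u v]).
Proof.
rewrite line_onE => /orP[/infix2P[p [q E]]|/infix2P[p [q E]]].
  have oa : orients a (p ++ [:: u, v & q]) by left.
  by exists p; have [_ ->] := tailE oa.
have oa : orients a (rev q ++ [:: u, v & rev p]).
  by right; rewrite E rev_cat !rev_cons -!cats1 -!catA.
by exists (rev q); have [_ ->] := tailE oa.
Qed.

Lemma tail_step a u v w s : tail a u v = w :: s ->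
  [/\ line_on L u v a, line_on L v w a, tail a v w = s
    & tail a w v = u :: tail a v u].
Proof.
move=> E; have on_a : line_on L u v a.
  apply/negPn/negP; rewrite line_onE => /norP[/negbTE h1 /negbTE h2].
  by move: E; rewrite /tail h1 h2.
have [p oa] := line_onP on_a; rewrite {}E in oa.
have [on_vw Evw] : line_on L v w a /\ tail a v w = s.
  by apply: (@tailE a (rcons p u)); rewrite cat_rcons.
have rE : rev (p ++ [:: u, v, w & s]) = rev s ++ [:: w, v, u & rev p].
  by rewrite rev_cat !rev_cons -!cats1 -!catA.
have oa' := orients_rev oa; rewrite rE in oa'.
have [_ Ewv] := tailE oa'.
split=> //; rewrite Ewv; congr (_ :: _).
by have [|_ ->] := @tailE a (rcons (rev s) w) (rev p) v u; rewrite ?cat_rcons.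
Qed.

(** A simple path visits [v] once. If the two edges were read in opposite orientations, [w] and [u]
    would both be the successor of [v] in one of them. *)
Lemma tail_through a u v w : line_on L u v a -> line_on L v w a -> w != u ->
  tail a u v = w :: tail a v w.
Proof.
move=> /line_onP[p oa] /line_onP[p' oa'] wu.
have us := orients_uniq oa.
have [E|E] := orients_eq oa oa'.
  apply: (@uniq_cat_cons_inj _ v (rcons p u) _ p'); rewrite cat_rcons //.
have [E2 _] : w :: tail a v w = u :: rev p.
  apply: (@uniq_cat_cons_inj _ v p' _ (rev (tail a u v))).
    exact: orients_uniq oa'.
  by rewrite E rev_cat !rev_cons -!cats1 -!catA.
by rewrite E2 eqxx in wu.
Qed.

Lemma notin_tail a u v : line_on L u v a -> u \notin v :: tail a u v.
Proof.
move=> /line_onP[p /orients_uniq]; rewrite cat_uniq => /and3P[_ _].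
by rewrite cons_uniq => /andP[].
Qed.

Lemma line_on_edge a u v : line_on L u v a -> edge G u v.
Proof.
have H x y : infix [:: x; y] (route L a) -> edge G x y.
  move=> /infix2P[p [q E]]; have := route_path L a; rewrite E.
  by case: p {E} => /= [/andP[]//|z p]; rewrite cat_path /= => /and4P[].
by rewrite line_onE => /orP[/H //|/H]; rewrite edge_sym.
Qed.

Definition before pi u v a b := index a (pi u v) < index b (pi u v).

(* Clockwise position of the port of [w] at [v], counted from the port of [u];
   appending [enum V] makes it injective on all of [V]. *)
Definition port_rank v u w :=
  index w (rot (index u (ports G v)) (ports G v) ++ enum V).

Lemma port_rank_inj v u w w' : port_rank v u w = port_rank v u w' -> w = w'.
Proof.
rewrite /port_rank; set r := _ ++ _.
have mr x : x \in r by rewrite mem_cat mem_enum orbT.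
by move=> E; rewrite -(nth_index v (mr w)) E nth_index.
Qed.

(* [beyond D pi u v s t a b]: two lines that run together along (u,v) and
   continue as [s] and [t] must have [a] before [b] at (u,v) because of the
   first place beyond [v] where they fork or share an edge of [D]. *)
Fixpoint beyond D pi u v (s t : seq V) a b : bool :=
  match s, t with
  | w :: s', w' :: t' =>
      if w == w' then
        if D v w then before pi v w a b else beyond D pi v w s' t' a b
      else port_rank v u w < port_rank v u w'
  | _, _ => false
  end.

(** Unlike [beyond], this also consults the edge (u,v) itself, which makes it the form of a demand
    that passes from one shared edge to the next. *)
Definition lookahead D pi u v a b :=
  if D u v then before pi u v a b
  else beyond D pi u v (tail a u v) (tail b u v) a b.

Lemma beyond_irr D pi u v s a : beyond D pi u v s s a a = false.
Proof.
elim: s u v => //= w s IH u v; rewrite eqxx IH.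
by rewrite /before ltnn; case: ifP.
Qed.

Lemma beyond_trans D pi u v s1 s2 s3 a b c :
  beyond D pi u v s1 s2 a b -> beyond D pi u v s2 s3 b c ->
  beyond D pi u v s1 s3 a c.
Proof.
elim: s1 u v s2 s3 => [|w1 s1 IH] u v [|w2 s2] [|w3 s3] //=.
case: (eqVneq w1 w2) => [<-|n12].
  case: (eqVneq w1 w3) => [_|//].
  by case: ifP => _; [apply: ltn_trans | apply: IH].
case: (eqVneq w2 w3) => [<-|n23]; first by rewrite (negbTE n12).
move=> h12 h23; have h13 := ltn_trans h12 h23.
by case: (eqVneq w1 w3) h13 => [->|//]; rewrite ltnn.
Qed.

(** Neither comparable pair is decided by a tail that ends, so while all four tails agree they are
    all nonempty. At the first split, one of [a], [b] forks from one of [c], [d], and distinct ports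
    have distinct ranks; on a common edge of [D], positions decide. *)
Lemma beyond_no_2K2 D pi u v s1 s2 s3 s4 a b c d :
  let B := beyond D pi u v in
  B s1 s2 a b -> B s3 s4 c d ->
  [|| B s1 s3 a c, B s3 s1 c a, B s1 s4 a d, B s4 s1 d a,
      B s2 s3 b c, B s3 s2 c b, B s2 s4 b d | B s4 s2 d b].
Proof.
rewrite /=; have split_rank x y w w' : w != w' ->
    (port_rank x y w < port_rank x y w') || (port_rank x y w' < port_rank x y w).
  move=> ne; rewrite -neq_ltn; apply: contra_neq ne; exact: port_rank_inj.
elim: s1 u v s2 s3 s4 => [|w1 s1 IH] u v [|w2 s2] [|w3 s3] [|w4 s4] //=.
case: (eqVneq w1 w2) => [<-|n12].
  case: (eqVneq w1 w3) => [<-|n13].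
    case: (eqVneq w1 w4) => [<-|n14]; last first.
      by move=> _ _; case/orP: (split_rank v u _ _ n14) => ->; rewrite ?orbT.
    case: ifP => _; last exact: IH.
    rewrite /before; set ka := index a _; set kb := index b _; set kc := index c _; set kd := index d _.
    (* A tie of positions is not excluded here; if [a] ties with [c], then [c] before [d] reads as
       [a] before [d]. *)
    by move=> ab cd; case: (ltngtP ka kc) => // ->; rewrite cd ?orbT.
  by move=> _ _; case/orP: (split_rank v u _ _ n13) => ->; rewrite ?orbT.
move=> _ _.
case: (eqVneq w1 w3) => [<-|n13]; last first.
  by case/orP: (split_rank v u _ _ n13) => ->; rewrite ?orbT.
rewrite (eq_sym w2) (negbTE n12).
by case/orP: (split_rank v u _ _ n12) => ->; rewrite ?orbT.
Qed.

End Lines.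

(** * Ordering the edges one at a time *)

Section Greedy.
Variables (V : finType) (G : plane_graph V).
Variables (Line : finType) (L : line_set G Line).
Implicit Types (a b c : Line) (u v w x : V) (D : rel V).
Implicit Types (pi : V -> V -> seq Line).

Notation beyond_tails D pi u v a b :=
  (beyond G D pi u v (tail L a u v) (tail L b u v) a b).

(** With this as [D], only forks decide in [beyond] and the layout is never consulted. *)
Definition no_edges : rel V := fun _ _ => false.

(** The greedy invariant. Reversal at opposite ports excludes edge crossings; as [D] is symmetric,
    the last clause covers the demands beyond both ends of an edge. *)
Definition partial_layout D pi := [/\ symmetric D, subrel D (edge G),
  forall u v, D u v ->
    [/\ uniq (pi u v), pi u v =i line_on L u v & pi v u = rev (pi u v)]
  & forall u v a b, D u v -> beyond_tails D pi u v a b -> before pi u v a b].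

Lemma before_swap D pi u v a b : partial_layout D pi -> D u v ->
  line_on L u v a -> line_on L u v b -> before pi v u a b = before pi u v b a.
Proof.
move=> [_ _ H _] Duv ha hb; have [us ms E] := H _ _ Duv.
by rewrite /before E ltn_index_rev // ms.
Qed.

Lemma before_total pi u v a b : a \in pi u v -> a != b ->
  before pi u v a b || before pi u v b a.
Proof.
move=> ha ab; rewrite /before -neq_ltn; apply: contra_neq ab => E.
have hb : b \in pi u v by rewrite -index_mem -E index_mem.
by rewrite -(nth_index a ha) E nth_index.
Qed.

Lemma beyond_line_on D pi u v a b : beyond_tails D pi u v a b ->
  [/\ line_on L u v a, line_on L u v b & a != b].
Proof.
case Ea: (tail L a u v) => [|w s] //; case Eb: (tail L b u v) => [|w' t] // h.
have [-> _ _ _] := tail_step Ea; have [-> _ _ _] := tail_step Eb; split=> //.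
by apply/eqP=> ab; move: h; rewrite -Ea -Eb ab beyond_irr.
Qed.

Lemma beyond_forward D pi u v w a b s t :
  tail L a u v = w :: s -> tail L b u v = w :: t ->
  beyond_tails D pi u v a b = lookahead L D pi v w a b.
Proof.
move=> Ea Eb; have [_ _ Ea' _] := tail_step Ea; have [_ _ Eb' _] := tail_step Eb.
by rewrite Ea Eb /= eqxx /lookahead Ea' Eb'.
Qed.

Lemma beyond_backward D pi u v w a b s t :
  tail L a u v = w :: s -> tail L b u v = w :: t ->
  beyond_tails D pi w v a b = lookahead L D pi v u a b.
Proof.
move=> Ea Eb; have [_ _ _ Ea'] := tail_step Ea; have [_ _ _ Eb'] := tail_step Eb.
by apply: beyond_forward Ea' Eb'.
Qed.

(** Demands for [a] first from both directions contradict each other. Walking forward with this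
    conflict, an edge of [D] would obey the demand from behind and so violate the one ahead; hence
    the walk can only end at a fork. *)
Lemma lookahead_forks D pi u v a b : partial_layout D pi ->
  line_on L u v a -> line_on L u v b ->
  lookahead L D pi u v a b -> lookahead L D pi v u a b ->
  beyond_tails no_edges pi u v a b.
Proof.
move=> PL; have [Dsym _ _ Dinv] := PL.
have swapF x y : D x y -> line_on L x y a -> line_on L x y b ->
    before pi x y a b -> before pi y x a b -> False.
  move=> Dxy ha hb; rewrite (before_swap PL Dxy ha hb) /before => h1 h2.
  by have := ltn_trans h1 h2; rewrite ltnn.
move Es: (tail L a u v) => s; elim: s u v Es => [|w s IH] u v Ea ha hb.
  rewrite {1}/lookahead Ea; case: ifP => // Duv h1.
  by rewrite /lookahead Dsym Duv => h2; case: (swapF _ _ Duv).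
rewrite {1}/lookahead; case: ifP => [Duv h1|Duv].
  by rewrite /lookahead Dsym Duv => h2; case: (swapF _ _ Duv).
case Eb: (tail L b u v) => [|w' t]; first by rewrite Ea.
case: (eqVneq w w') => [E|ne]; last by rewrite Ea /= (negbTE ne).
rewrite -{}E {w'} in Eb *; rewrite -Eb (beyond_forward _ _ Ea Eb) => h1.
rewrite -(beyond_backward _ _ Ea Eb) => h2.
have [_ ha' Ea' _] := tail_step Ea; have [_ hb' Eb' _] := tail_step Eb.
case Dvw: (D v w); last first.
  rewrite Eb /= eqxx -Eb'; apply: IH => //.
  by rewrite /lookahead Dsym Dvw.
move: h1; rewrite /lookahead Dvw => h1.
by case: (swapF _ _ Dvw ha' hb' h1); apply: Dinv h2; rewrite Dsym.
Qed.

(** Clockwise orders at the two ends of an edge run against each other, so forks asking for [a]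
    first at both ends force a conflict. This is derived later from the absence of unavoidable
    crossings. *)
Hypothesis forks_consistent : forall pi u v a b,
  beyond_tails no_edges pi u v a b -> beyond_tails no_edges pi v u a b -> False.

Lemma lookahead_consistent D pi u v a b : partial_layout D pi ->
  line_on L u v a -> line_on L u v b ->
  lookahead L D pi u v a b -> lookahead L D pi v u a b -> False.
Proof.
move=> PL ha hb h1 h2; apply: (@forks_consistent pi u v a b).
  exact: lookahead_forks h2.
by apply: lookahead_forks h1; rewrite // line_on_sym.
Qed.

Lemma order_edge D pi u v : partial_layout D pi -> edge G u v -> ~~ D u v ->
  exists s, [/\ uniq s, s =i line_on L u v,
    forall a b, beyond_tails D pi u v a b -> index a s < index b s
  & forall a b, beyond_tails D pi v u a b -> index b s < index a s].
Proof.
move=> PL Euv nDuv; have [Dsym _ _ _] := PL.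
(* The arguments of [B] are swapped because an order read at [v] appears reversed at [u]; both
   relations now constrain the order at [u]. *)
pose F a b := beyond_tails D pi u v a b; pose B a b := beyond_tails D pi v u b a.
have [||||||| s [us ms ls]] := @joint_linear_extension _ F B _ _ _ _ _ _ _ (line_on L u v).
- by move=> b a c; apply: beyond_trans.
- by move=> b a c h1 h2; apply: beyond_trans h2 h1.
- by move=> a; apply: beyond_irr.
- by move=> a; apply: beyond_irr.
- move=> a b Fab Bba; have [ha hb _] := beyond_line_on Fab.
  by apply: (lookahead_consistent PL ha hb); rewrite /lookahead ?[D v u]Dsym (negbTE nDuv).
- by move=> a b c d; apply: beyond_no_2K2.
- move=> a b c d h1 h2; have := beyond_no_2K2 h1 h2; rewrite /B.
  by case/or4P=> [h|h|h|/or4P[h|h|h|/orP[h|h]]]; rewrite h ?orbT.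
exists s; split=> // a b h.
  by have [ha hb _] := beyond_line_on h; apply: ls => //; rewrite /F h.
have [ha hb _] := beyond_line_on h; rewrite line_on_sym in ha.
by rewrite line_on_sym in hb; apply: ls => //; rewrite /B h orbT.
Qed.

(** * Adding one ordered edge to a partial layout *)

Section Extend.
Variables (D : rel V) (pi : V -> V -> seq Line) (u0 v0 : V) (s0 : seq Line).
Hypotheses (PL : partial_layout D pi) (E0 : edge G u0 v0) (nD0 : ~~ D u0 v0).
Hypotheses (us0 : uniq s0) (ms0 : s0 =i line_on L u0 v0).
Hypothesis fwd0 :
  forall a b, beyond_tails D pi u0 v0 a b -> index a s0 < index b s0.
Hypothesis bwd0 :
  forall a b, beyond_tails D pi v0 u0 a b -> index b s0 < index a s0.

Definition newD : rel V :=
  fun x y => [|| D x y, (x, y) == (u0, v0) | (x, y) == (v0, u0)].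

Definition newpi x y := if (x, y) == (u0, v0) then s0
  else if (x, y) == (v0, u0) then rev s0 else pi x y.

Let Dsym : symmetric D. Proof. by case: PL. Qed.

Lemma newpi_old x y : D x y -> newpi x y = pi x y.
Proof.
move=> Dxy; rewrite /newpi.
case: eqP => [[Ex Ey]|_]; first by move: nD0; rewrite -Ex -Ey Dxy.
by case: eqP => [[Ex Ey]|_] //; move: nD0; rewrite -Ex -Ey Dsym Dxy.
Qed.

Lemma newpi_new : newpi u0 v0 = s0.
Proof. by rewrite /newpi eqxx. Qed.

Lemma newpi_new_rev : newpi v0 u0 = rev s0.
Proof.
rewrite /newpi eqxx; case: eqP => // -[E _].
by move: E0; rewrite E edge_irr.
Qed.

Lemma newD_sym : symmetric newD.
Proof.
by move=> x y; rewrite /newD Dsym !xpair_eqE [(y == u0) && _]andbC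
  [(y == v0) && _]andbC; congr (_ || _); rewrite orbC.
Qed.

Lemma newD_before_swap x y a b : newD x y ->
  line_on L x y a -> line_on L x y b ->
  before newpi y x a b = before newpi x y b a.
Proof.
rewrite /newD => /or3P[Dxy|/eqP[-> ->]|/eqP[-> ->]] ha hb.
- have Dyx : D y x by rewrite Dsym.
  by rewrite /before !newpi_old //; apply: before_swap PL Dxy ha hb.
- by rewrite /before newpi_new newpi_new_rev ltn_index_rev ?ms0.
- rewrite line_on_sym in ha; rewrite line_on_sym in hb.
  by rewrite /before newpi_new newpi_new_rev ltn_index_rev ?ms0.
Qed.

Lemma before_newpi_rev a b : line_on L u0 v0 a -> line_on L u0 v0 b ->
  before newpi v0 u0 a b = before newpi u0 v0 b a.
Proof. by apply: newD_before_swap; rewrite /newD eqxx orbT. Qed.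

Lemma lookahead_new x y a b : newD x y -> line_on L x y a -> line_on L x y b ->
  lookahead L D pi x y a b -> before newpi x y a b.
Proof.
rewrite /newD => /or3P[Dxy|/eqP[-> ->]|/eqP[-> ->]] ha hb.
- by rewrite /lookahead /before Dxy newpi_old.
- by rewrite /lookahead (negbTE nD0) => /fwd0; rewrite /before newpi_new.
- rewrite line_on_sym in ha; rewrite line_on_sym in hb.
  rewrite /lookahead Dsym (negbTE nD0) => /bwd0.
  by rewrite before_newpi_rev // /before newpi_new.
Qed.

(** Walk forward along the shared path, carrying the old demand from behind. An ordered edge, old or
    new, obeys it and so cannot demand the opposite; a fork reached first is an old demand, excluded
    by [lookahead_consistent]. *)
Lemma new_not_against_old x y a b : line_on L x y a -> line_on L x y b ->
  lookahead L D pi y x a b -> lookahead L newD newpi x y a b -> False.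
Proof.
have swapF z t : newD z t -> line_on L z t a -> line_on L z t b ->
    before newpi z t a b -> before newpi t z a b -> False.
  move=> Dzt ha hb; rewrite (newD_before_swap Dzt ha hb) /before => h1 h2.
  by have := ltn_trans h1 h2; rewrite ltnn.
move Es: (tail L a x y) => s; elim: s x y Es => [|w s IH] x y Ea ha hb old.
  rewrite /lookahead Ea; case: ifP => // Dxy h.
  apply: (swapF _ _ Dxy ha hb h); apply: lookahead_new old; rewrite 1?newD_sym //.
    by rewrite line_on_sym.
  by rewrite line_on_sym.
case Dxy: (newD x y).
  rewrite /lookahead Dxy => h.
  apply: (swapF _ _ Dxy ha hb h); apply: lookahead_new old; rewrite 1?newD_sym //.
    by rewrite line_on_sym.
  by rewrite line_on_sym.
have nDxy : D x y = false by apply: contraFF Dxy; rewrite /newD => ->.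
rewrite /lookahead Dxy.
case Eb: (tail L b x y) => [|w' t]; first by rewrite Ea.
case: (eqVneq w w') => [E|ne].
  rewrite -{}E {w'} in Eb *; rewrite -Eb (beyond_forward _ _ Ea Eb) => new.
  have [_ ha' Ea' _] := tail_step Ea; have [_ hb' Eb' _] := tail_step Eb.
  move: old; rewrite -(beyond_backward _ _ Ea Eb) => old.
  case Dyw: (D y w); last first.
    by apply: (IH y w) new => //; rewrite /lookahead Dsym Dyw.
  have nDyw : newD y w by rewrite /newD Dyw.
  move: new; rewrite /lookahead nDyw => new.
  apply: (swapF _ _ nDyw ha' hb' new); rewrite /before newpi_old 1?Dsym //.
  by case: PL => _ _ _; apply; rewrite // Dsym.
rewrite Ea /= (negbTE ne) => rk.
apply: (lookahead_consistent PL ha hb) old.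
by rewrite /lookahead nDxy Ea Eb /= (negbTE ne).
Qed.

(** A walk that misses an endpoint of the new edge never traverses it. By simplicity this applies to
    the tails beyond the new edge, so ordering it leaves its own demands unchanged. *)
Lemma beyond_avoid z x y s t a b : z \in [:: u0; v0] -> z \notin y :: s ->
  beyond G newD newpi x y s t a b = beyond G D pi x y s t a b.
Proof.
move=> zE; elim: s x y t => [|w s IH] x y [|w' t] //= nz.
case: eqP => // _.
have nzws : z \notin w :: s by move: nz; rewrite inE => /norP[].
rewrite IH //; have -> : newD y w = D y w.
  rewrite /newD; case: eqP => [[Ey Ew]|_].
    by move: zE nz; rewrite Ey Ew !inE => /orP[] /eqP ->; rewrite eqxx /= ?orbT.
  case: eqP => [[Ey Ew]|_]; last by rewrite !orbF.
  by move: zE nz; rewrite Ey Ew !inE => /orP[] /eqP ->; rewrite eqxx /= ?orbT.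
by case: ifP => // Dyw; rewrite /before newpi_old.
Qed.

Lemma extend_partial_layout : partial_layout newD newpi.
Proof.
have [_ Dedge Dlay Dinv] := PL.
split; first exact: newD_sym.
- move=> x y; rewrite /newD => /or3P[/Dedge //|/eqP[-> ->] //|/eqP[-> ->]].
  by rewrite edge_sym.
- move=> x y; rewrite /newD => /or3P[Dxy|/eqP[-> ->]|/eqP[-> ->]].
  + by rewrite !newpi_old // 1?Dsym //; apply: Dlay.
  + by rewrite newpi_new newpi_new_rev.
  + rewrite newpi_new newpi_new_rev revK rev_uniq; split=> // a.
    by rewrite mem_rev ms0; apply: line_on_sym.
move=> x y a b; rewrite {1}/newD => /or3P[Dxy|/eqP[-> ->]|/eqP[-> ->]] h.
- have [ha hb ab] := beyond_line_on h.
  have [_ ms _] := Dlay _ _ Dxy.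
  rewrite /before newpi_old //.
  (* Were [b] first on this old edge, then from beyond [y] the edge itself would be an old demand
     for [a] first, against the new demand ahead unless that one is already old. *)
  have /orP[//|ba] := before_total (etrans (ms a) ha) ab.
  rewrite -(before_swap PL Dxy ha hb) in ba.
  case Ea: (tail L a x y) h => [|w s] //; case Eb: (tail L b x y) => [|w' t] //.
  case: (eqVneq w w') => [E|ne]; last first.
    by rewrite /= (negbTE ne) => rk; apply: Dinv => //; rewrite Ea Eb /= (negbTE ne).
  rewrite -{}E {w'} in Eb *; rewrite -Ea -Eb (beyond_forward _ _ Ea Eb) => new.
  have [_ ha' Ea' _] := tail_step Ea; have [_ hb' Eb' _] := tail_step Eb.
  case Dyw: (D y w).
    apply: Dinv => //; rewrite (beyond_forward _ _ Ea Eb); move: new.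
    by rewrite /lookahead /newD Dyw /= /before newpi_old.
  case: (new_not_against_old ha' hb' _ new).
  rewrite /lookahead Dsym Dyw (beyond_backward _ _ Ea Eb).
  by rewrite /lookahead Dsym Dxy.
- have [ha hb _] := beyond_line_on h.
  rewrite /before newpi_new; apply: fwd0; move: h.
  by rewrite (@beyond_avoid u0) ?notin_tail // !inE eqxx.
- have [ha hb _] := beyond_line_on h.
  rewrite before_newpi_rev 1?line_on_sym // /before newpi_new; apply: bwd0.
  by move: h; rewrite (@beyond_avoid v0) ?notin_tail // !inE eqxx orbT.
Qed.

End Extend.
Lemma extend_layout D pi u v : partial_layout D pi -> edge G u v ->
  exists D' pi', [/\ partial_layout D' pi', subrel D D' & D' u v].
Proof.
move=> PL Euv; case Duv: (D u v); first by exists D, pi; split.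
have [s [us ms fs bs]] := order_edge PL Euv (negbT Duv).
exists (newD D u v), (newpi pi u v s); split.
- exact: (extend_partial_layout PL Euv (negbT Duv) us ms fs bs).
- by move=> x y Dxy; rewrite /newD Dxy.
- by rewrite /newD eqxx orbT.
Qed.

Lemma full_partial_layout : exists D pi, partial_layout D pi /\ D =2 edge G.
Proof.
have [D [pi [PL DE]]] : exists D pi, partial_layout D pi /\
    {in enum {: V * V}, forall d, edge G d.1 d.2 -> D d.1 d.2}.
  elim: (enum _) => [|d ds [D [pi [PL DE]]]].
    by exists no_edges, (fun _ _ => [::]); split.
  case Ed: (edge G d.1 d.2); last first.
    exists D, pi; split=> // x; rewrite inE => /predU1P[->|/DE //].
    by rewrite Ed.
  have [D' [pi' [PL' sub D'd]]] := extend_layout PL Ed.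
  exists D', pi'; split=> // x; rewrite inE => /predU1P[-> //|/DE h /h].
  exact: sub.
exists D, pi; split=> // u v; have [_ sub _ _] := PL.
by apply/idP/idP=> [/sub //|Euv]; apply: (DE (u, v)); rewrite ?mem_enum.
Qed.

End Greedy.

(** * Vertex crossings and the fork condition *)

Section Vertices.
Variables (V : finType) (G : plane_graph V).
Variables (Line : finType) (L : line_set G Line).
Implicit Types (a b c : Line) (p q u v w x : V).
Implicit Types (pi : V -> V -> seq Line).

Definition other_ports v p : seq V :=
  behead (rot (index p (ports G v)) (ports G v)).

Lemma rot_ports v p : edge G v p ->
  rot (index p (ports G v)) (ports G v) = p :: other_ports v p.
Proof. by rewrite -mem_ports /other_ports => /rot_index ->. Qed.

Lemma other_ports_uniq v p : edge G v p -> uniq (p :: other_ports v p).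
Proof. by move=> /rot_ports <-; rewrite rot_uniq ports_uniq. Qed.

Lemma mem_other_ports v p x : edge G v p ->
  (x \in other_ports v p) = edge G v x && (x != p).
Proof.
move=> Evp; have := other_ports_uniq Evp; rewrite cons_uniq => /andP[np _].
rewrite -mem_ports -(mem_rot (index p (ports G v))) (rot_ports Evp) inE.
by case: (eqVneq x p) => [->|]; rewrite ?andbF ?andbT // (negbTE np).
Qed.

Lemma vertex_order_rot pi v p : edge G v p ->
  exists k, rot k (vertex_order G pi v) =
            pi v p ++ flatten [seq pi v x | x <- other_ports v p].
Proof.
move=> Evp; have [k E] := flatten_rot [seq pi v x | x <- ports G v] (index p (ports G v)).
by exists k; rewrite -E -map_rot rot_ports.
Qed.

Lemma mem_layout pi u v a : is_layout L pi -> line_on L u v a -> a \in pi u v.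
Proof. by move=> lay ha; have [_ ->] := lay _ _ (line_on_edge ha). Qed.

(** The condition mirrors one step of [beyond] at [v]: whether the order at a common port or the
    ranks of two ports decide, [a] comes first clockwise after the port of [p]. *)
Lemma subseq_other_ports pi v p a b qa qb sa sb : is_layout L pi -> a != b ->
  tail L a p v = qa :: sa -> tail L b p v = qb :: sb ->
  (if qa == qb then before pi v qa a b
   else port_rank G v p qa < port_rank G v p qb) ->
  subseq [:: a; b] (flatten [seq pi v x | x <- other_ports v p]).
Proof.
move=> lay ab Ea Eb.
have [hpa hva _ _] := tail_step Ea; have [hpb hvb _ _] := tail_step Eb.
have Evp : edge G v p by rewrite edge_sym (line_on_edge hpa).
have memq c q s : tail L c p v = q :: s -> q \in other_ports v p.
  move=> Ec; have [hc hc' _ _] := tail_step Ec.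
  rewrite mem_other_ports // (line_on_edge hc') /=.
  by have := notin_tail hc; rewrite Ec !inE !negb_or => /and3P[_]; rewrite eq_sym.
have qao := memq _ _ _ Ea; have qbo := memq _ _ _ Eb.
have := other_ports_uniq Evp; rewrite cons_uniq => /andP[npo uo].
case: (eqVneq qa qb) => [Eq lt|ne].
  have hb : b \in pi v qa by rewrite Eq mem_layout.
  apply: subseq_trans (subseq2_index ab hb lt) _.
  have := @flatten_subseq _ [:: pi v qa] [seq pi v x | x <- other_ports v p].
  by rewrite sub1seq (map_f (pi v) qao) /= cats0; apply.
rewrite /port_rank rot_ports //= !index_cat qao qbo.
case: (eqVneq p qa) => [E|_]; first by rewrite -E (negbTE npo) in qao.
case: (eqVneq p qb) => [E|_]; first by rewrite -E (negbTE npo) in qbo.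
rewrite ltnS => lt.
have /(map_subseq (pi v))/flatten_subseq /= sub := subseq2_index ne qbo lt.
apply: subseq_trans sub; rewrite cats0 -[[:: a; b]]/([:: a] ++ [:: b]).
by apply: cat_subseq; rewrite sub1seq mem_layout.
Qed.

Lemma vertex_crossing_intro pi v p a b : a != b -> edge G v p ->
  b \in pi v p -> before pi v p a b ->
  subseq [:: a; b] (flatten [seq pi v x | x <- other_ports v p]) ->
  vertex_crossing G pi v a b.
Proof.
move=> ab Evp hb lt sub; have [k E] := vertex_order_rot pi Evp.
exists k; rewrite E -[[:: a; b; a; b]]/([:: a; b] ++ [:: a; b]).
exact: cat_subseq (subseq2_index ab hb lt) sub.
Qed.

Lemma count_layout pi v (o : seq V) a : is_layout L pi -> {subset o <= edge G v} ->
  count_mem a (flatten [seq pi v x | x <- o]) =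
  count (fun x => line_on L v x a) o.
Proof.
move=> lay sub; rewrite count_flatten -map_comp -sumn_count; congr sumn.
apply/eq_in_map => x /sub Evx /=; have [us ms] := lay _ _ Evx.
by rewrite count_uniq_mem // ms.
Qed.

(** Suppose [b] is first at (u,v). Without an edge crossing, [a] is first at the port of [v] for
    [u]; by the fork, or by induction along the next shared edge, [a] is also first on the remaining
    ports of [v], which gives the alternation [a b a b]. *)
Lemma noncrossing_follows_forks pi a b u v pi0 : is_layout L pi -> ~ crosses G pi a b ->
  beyond G (@no_edges V) pi0 u v (tail L a u v) (tail L b u v) a b ->
  before pi u v a b.
Proof.
move=> lay nc; move Es: (tail L a u v) => s; elim: s u v Es => // w s IH u v Ea h.
have [ha hb ab] : [/\ line_on L u v a, line_on L u v b & a != b].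
  by apply: (beyond_line_on (D := @no_edges V) (pi := pi0)); rewrite Ea.
have /orP[//|ba] := before_total (mem_layout lay ha) ab.
case: nc; have Euv := line_on_edge ha.
have Evu : edge G v u by rewrite edge_sym.
have ha' : line_on L v u a by rewrite line_on_sym.
have hb' : line_on L v u b by rewrite line_on_sym.
have /orP[ab'|ba'] := before_total (mem_layout lay ha') ab; last first.
  left; exists u, v; split=> //; right.
  by split; apply: subseq2_index; rewrite 1?eq_sym ?mem_layout.
right; exists v; apply: (vertex_crossing_intro ab Evu _ ab'); first exact: mem_layout.
case Eb: (tail L b u v) h => [|w' t] //= h.
apply: (subseq_other_ports lay ab Ea Eb).
case: ifP h => // /eqP E; rewrite -{}E {w'} in Eb * => h.
have [_ _ Ea' _] := tail_step Ea; have [_ _ Eb' _] := tail_step Eb.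
by apply: IH; rewrite // Eb'.
Qed.

Hypothesis no_unavoidable : forall a b, a <> b -> ~ unavoidable L a b.

Lemma forks_consistent pi u v a b :
  beyond G (@no_edges V) pi u v (tail L a u v) (tail L b u v) a b ->
  beyond G (@no_edges V) pi v u (tail L a v u) (tail L b v u) a b -> False.
Proof.
move=> h1 h2; have [ha hb ab] := beyond_line_on h1.
apply: (@no_unavoidable a b); first exact/eqP.
(* A layout without a crossing of the pair would follow both forks and put [a] first at both ends of
   (u,v), which is an edge crossing. *)
move=> pi' lay; apply: NNPP => nc.
have b1 := noncrossing_follows_forks lay nc h1; have b2 := noncrossing_follows_forks lay nc h2.
apply: nc; left; exists u, v; split; first exact: line_on_edge ha.
by left; split; apply: subseq2_index => //; rewrite mem_layout // line_on_sym.
Qed.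

Lemma no_vertex_crossing D pi v a b : partial_layout L D pi -> D =2 edge G ->
  a <> b -> ~ vertex_crossing G pi v a b.
Proof.
move=> PL DE /eqP ab [k sub]; have [_ _ Dlay Dinv] := PL.
have lay : is_layout L pi.
  by move=> x y; rewrite -DE => /Dlay[].
have [/existsP[p /andP[hpa hpb]]|/existsPn np] :=
  boolP [exists p, line_on L v p a && line_on L v p b]; last first.
  (* Without a shared port at [v], each port holds at most one of the two lines, so their cyclic
     pattern is the same in all layouts and the crossing is unavoidable. *)
  apply: (@no_unavoidable a b); first exact/eqP.
  move=> pi' lay'; right; exists v.
  have [k1 E1] := filter_rot (pred2 a b) k (vertex_order G pi v).
  have E : filter (pred2 a b) (vertex_order G pi v) =
           filter (pred2 a b) (vertex_order G pi' v).
    rewrite /vertex_order !filter_flatten -!map_comp; congr flatten.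
    apply/eq_in_map => x; rewrite mem_ports => Evx /=.
    have [us ms] := lay _ _ Evx; have [us' ms'] := lay' _ _ Evx.
    by apply: filter_pred2_eq => // [y|]; rewrite !ms ?ms' // np.
  have [k2 E2] := rot_filter (pred2 a b) k1 (vertex_order G pi' v).
  exists k2; have : subseq [:: a; b; a; b] (filter (pred2 a b) (rot k (vertex_order G pi v))).
    by rewrite subseq_filter sub /= !eqxx !orbT.
  by rewrite E1 E E2 subseq_filter => /andP[].
have Evp := line_on_edge hpa; have Epv : edge G p v by rewrite edge_sym.
(* Read the vertex order from the shared port [p] onwards. *)
have [j Ej] := vertex_order_rot pi Evp.
set Y := _ ++ _ in Ej.
have [i Ei] := rotK_exists j (vertex_order G pi v).
have [k' Ek] := rot_rot_exists k i Y.
rewrite -Ei Ej Ek in sub.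
have sub_ports : {subset other_ports v p <= edge G v}.
  by move=> x; rewrite mem_other_ports // => /andP[].
(* A line occurring twice around [v] leaves through exactly one port besides [p], since by
   [tail_through] that port is the head of its tail. *)
have ucount c : line_on L v p c -> 1 < count_mem c Y ->
    count_mem c (pi v p) = 1 /\
    (count_mem c (flatten [seq pi v x | x <- other_ports v p]) = 1 /\
    exists q s, tail L c p v = q :: s).
  move=> hc; have [us ms] := lay _ _ Evp.
  have c1 : count_mem c (pi v p) = 1 by rewrite count_uniq_mem // ms [_ \in _]hc.
  rewrite count_cat c1 ltnS (count_layout _ lay sub_ports) -has_count.
  case/hasP=> q qo hq; have hpc : line_on L p v c by rewrite line_on_sym.
  have thr x : x \in other_ports v p -> line_on L v x c -> tail L c p v = x :: tail L c v x.
    rewrite mem_other_ports // => /andP[_ xp] hx; exact: tail_through.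
  split=> //; split; last by exists q, (tail L c v q); apply: thr.
  rewrite (@eq_in_count _ _ (pred1 q)).
    have := other_ports_uniq Evp; rewrite cons_uniq => /andP[_ uo].
    by rewrite count_uniq_mem // qo.
  move=> x xo /=; apply/idP/eqP=> [hx|-> //].
  by have := thr _ xo hx; rewrite (thr _ qo hq) => -[].
have count2 c : c \in [:: a; b] -> 1 < count_mem c Y.
  move=> cab; have := leq_count_subseq (pred1 c) sub.
  have /permP -> : perm_eq (rot k' Y) Y by rewrite perm_rot.
  apply: leq_trans.
  by move: cab; rewrite !inE /= => /orP[] /eqP ->; rewrite !eqxx ?addnA ?addn0; case: (_ == _).
have [ca1 [ca2 [qa [sa Ea]]]] : _ := ucount a hpa (count2 _ (mem_head _ _)).
have [cb1 [cb2 [qb [sb Eb]]]] : _ := ucount b hpb (count2 _ (mem_last a [:: b])).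
(* If [c] precedes [d] on the remaining ports, the invariant puts [c] first at (p,v), hence [d]
   first at (v,p). The pattern is then [d c c d], which does not alternate. It is used for both
   orders of [a] and [b]. *)
have main c d qc sc qd sd : c != d -> filter (pred2 c d) Y = filter (pred2 a b) Y ->
    line_on L v p c -> line_on L v p d ->
    count_mem c (pi v p) = 1 -> count_mem d (pi v p) = 1 ->
    count_mem c (flatten [seq pi v x | x <- other_ports v p]) = 1 ->
    count_mem d (flatten [seq pi v x | x <- other_ports v p]) = 1 ->
    tail L c p v = qc :: sc -> tail L d p v = qd :: sd ->
    (if qc == qd then before pi v qc c d
     else port_rank G v p qc < port_rank G v p qd) -> False.
  move=> cd Ecd hc hd c1 d1 c2 d2 Ec Ed lt.
  have sub2 := subseq_other_ports lay cd Ec Ed lt.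
  have bcd : before pi p v c d.
    apply: Dinv; rewrite ?DE // Ec Ed /=; case: ifP lt => // _.
    by have [_ /line_on_edge Eq _ _] := tail_step Ec; rewrite DE Eq.
  have bdc : before pi v p d c.
    by rewrite (before_swap PL) // ?DE // line_on_sym.
  have sub1 : subseq [:: d; c] (pi v p).
    by apply: subseq2_index; rewrite // 1?eq_sym // mem_layout.
  apply: (not_alternating (x := c) (y := d) ab _ sub).
  rewrite -Ecd filter_cat (filter_pred2 cd sub2 c2 d2).
  rewrite (@eq_filter _ _ (pred2 d c)) => [|x /=]; last exact: orbC.
  by rewrite filter_pred2 // eq_sym.
have ba : b != a by rewrite eq_sym.
have Eba : filter (pred2 b a) Y = filter (pred2 a b) Y.
  by apply: eq_filter => x /=; apply: orbC.
have Mab : (if qa == qb then before pi v qa a b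
  else port_rank G v p qa < port_rank G v p qb) -> False.
  exact: main ca1 cb1 ca2 cb2 Ea Eb.
have Mba : (if qb == qa then before pi v qb b a
  else port_rank G v p qb < port_rank G v p qa) -> False.
  exact: main cb1 ca1 cb2 ca2 Eb Ea.
have [_ hqa _ _] := tail_step Ea.
case: (eqVneq qa qb) Mab Mba => [<-|ne] Mab Mba.
  by have /orP[] := before_total (mem_layout lay hqa) ab.
have /orP[//|//] : (port_rank G v p qa < port_rank G v p qb) || (port_rank G v p qb < port_rank G v p qa).
by rewrite -neq_ltn; apply: contra_neq ne; apply: port_rank_inj.
Qed.

End Vertices.

Theorem theorem2 (V : finType) (G : plane_graph V)
    (Line : finType) (L : line_set G Line)
    (no_unavoidable : forall l1 l2 : Line, l1 <> l2 -> ~ unavoidable L l1 l2) :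
  exists pi : V -> V -> seq Line,
    [/\ feasible L pi,
        forall (u v : V) (l1 l2 : Line),
          l1 <> l2 -> ~ edge_crossing G pi u v l1 l2
      & forall (u : V) (l1 l2 : Line),
          l1 <> l2 -> ~ vertex_crossing G pi u l1 l2].
Proof.
have [D [pi [PL DE]]] := full_partial_layout (forks_consistent no_unavoidable).
have nvc v l1 l2 := @no_vertex_crossing _ _ _ _ no_unavoidable D pi v l1 l2 PL DE.
have [_ _ Dlay _] := PL.
exists pi; split=> [|u v a b ab [Euv cr]|//].
  split=> [u v|u a b ab /nvc //].
  by rewrite -DE => /Dlay[].
rewrite -DE in Euv; have [us ms E] := Dlay _ _ Euv.
(* The two ports of an edge carry mutually reversed orders. *)
have H c d : precedes c d (pi u v) -> precedes c d (pi v u) -> False.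
  move=> h1 h2; have mem x : x \in [:: c; d] -> x \in pi u v by apply: mem_subseq.
  have := index_subseq2 us h1; have : uniq (pi v u) by rewrite E rev_uniq.
  move/index_subseq2 => /(_ _ _ h2); rewrite E ltn_index_rev ?mem ?inE ?eqxx ?orbT //.
  by move=> lt1 lt2; have := ltn_trans lt1 lt2; rewrite ltnn.
by case: cr => -[]; apply: H.
Qed.
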